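(* Let $X_1\subseteq\cdots\subseteq X_L$ be nested point sets with $N_0:=0$, let $1\le m\le L$ and $N_{m-1}+1\le i\le N_m$. Then the multilevel cardinal basis function $b_i=A_L(\boldsymbol{e}_i^{(L)})$ has the representation $$b_i=\chi_i^{(L)}+\sum_{\ell=m}^{L-1}\left[\chi_i^{(\ell)}-A_{\{\ell+1,\ldots,L\}}\left(\chi_i^{(\ell)}\right)\right].$$
   Context: Let $\Omega\subseteq\mathbb{R}^d$ be a bounded domain and $X_1\subseteq X_2\subseteq\cdots\subseteq X_L\subseteq\Omega$ nested finite point sets, ordered so that $X_\ell=\{\boldsymbol{x}_1,\ldots,\boldsymbol{x}_{N_\ell}\}$ (distinct points) for $1\le\ell\le L$. Their fill distances $h_\ell=\sup_{\boldsymbol{x}\in\Omega}\min_{1\le i\le N_\ell}\|\boldsymbol{x}-\boldsymbol{x}_i\|_2$ satisfy $c\mu h_\ell\le h_{\ell+1}\le\mu h_\ell$ with fixed $\mu\in(0,1)$, $c\in(0,1]$. Let $\Phi:\mathbb{R}^d\to\mathbb{R}$ be a positive definite radial basis function (continuous, with all matrices $(\Phi(\boldsymbol{y}_i-\boldsymbol{y}_j))_{i,j}$ for distinct points positive definite) with support in the closed unit ball, and let $\Phi_\ell=\delta_\ell^{-d}\Phi(\cdot/\delta_\ell)$ with $\delta_\ell=\nu h_\ell$ and a fixed $\nu>1$. Let $W_\ell=\operatorname{span}\{\Phi_\ell(\cdot-\boldsymbol{x}_i):1\le i\le N_\ell\}$, and let $\chi_i^{(\ell)}\in W_\ell$, $1\le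 i\le N_\ell$, be the Lagrange (cardinal) functions, i.e. the unique elements of $W_\ell$ with $\chi_i^{(\ell)}(\boldsymbol{x}_j)=\delta_{ij}$ for $1\le j\le N_\ell$. The interpolation operator is $I_{X_\ell,\Phi_\ell}(g)=\sum_{i=1}^{N_\ell}g(\boldsymbol{x}_i)\chi_i^{(\ell)}$ for $g\in C(\Omega)$. For $f\in C(\Omega)$ put $e_0=f$ and, for $\ell\ge1$, $s_\ell=I_{X_\ell,\Phi_\ell}(e_{\ell-1})$, $e_\ell=e_{\ell-1}-s_\ell$; the multilevel operator is $A_L(f)=\sum_{\ell=1}^L s_\ell$. Since the sets are nested, $A_L(f)$ depends only on $f|_{X_L}\in\mathbb{R}^{N_L}$; for $\boldsymbol{y}\in\mathbb{R}^{N_L}$ one writes $A_L(\boldsymbol{y}):=A_L(f)$ for any $f\in C(\Omega)$ with $f|_{X_L}=\boldsymbol{y}$. $\boldsymbol{e}_i^{(L)}$ is the $i$-th unit vector of $\mathbb{R}^{N_L}$. For a nonempty set $\mathfrak{u}=\{u_1<u_2<\cdots<u_{|\mathfrak{u}|}\}\subseteq\{1,\ldots,L\}$ put $\mathcal{I}_{\mathfrak{u}}=I_{X_{u_{|\mathfrak{u}|}},\Phi_{u_{|\mathfrak{u}|}}}\cdots I_{X_{u_2},\Phi_{u_2}}I_{X_{u_1},\Phi_{u_1}}$ (composition, with $I_{X_{u_1},\Phi_{u_1}}$ applied first). The multilevel operator starting at level $\ell+1$ is $$A_{\{\ell+1,\ldots,L\}}(f):=\sum_{\emptyset\ne\mathfrak{u}\subseteq\{\ell+1,\ldots,L\}}(-1)^{|\mathfrak{u}|+1}\mathcal{I}_{\mathfrak{u}}(f).$$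 *)

(* Defs.v *)
From HB Require Import structures.
From mathcomp Require Import all_boot all_order all_algebra.
From mathcomp Require Import all_classical all_reals all_analysis.
Set Implicit Arguments.
Unset Strict Implicit.
Unset Printing Implicit Defensive.
Import Order.TTheory GRing.Theory Num.Theory.
Import numFieldNormedType.Exports.
Local Open Scope classical_set_scope.
Local Open Scope ring_scope.

(* The norm MathComp-Analysis puts on 'rV[R]_d is the maximum norm; fill
   distances and supports are measured in the Euclidean norm. *)
Definition enorm (R : realType) (d : nat) (v : 'rV[R]_d) : R :=
  Num.sqrt (\sum_(k < d) v 0 k ^+ 2).

(* Points are numbered from 0: the point set of size n is x 0, ..., x n.-1.
   The value x 0, which seeds the minimum, is itself one of the minimised
   terms as soon as 0 < n. *)
Definition fill_distance (R : realType) (d : nat) (Om : set 'rV[R]_d)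
    (x : nat -> 'rV[R]_d) (n : nat) : R :=
  sup [set \big[Num.min/enorm (z - x 0%N)]_(i < n) enorm (z - x i) | z in Om].

Definition posdefmx (R : realType) (n : nat) (A : 'M[R]_n) : Prop :=
  A^T = A /\ forall v : 'rV[R]_n, v != 0 -> 0 < (v *m A *m v^T) 0 0.

Definition positive_definite (R : realType) (d : nat)
    (K : 'rV[R]_d -> R) : Prop :=
  forall (n : nat) (y : 'I_n -> 'rV[R]_d), injective y ->
    posdefmx (\matrix_(i < n, j < n) K (y i - y j)).

Definition radial (R : realType) (d : nat) (K : 'rV[R]_d -> R) : Prop :=
  exists phi : R -> R, forall v, K v = phi (enorm v).

Definition scaled_kernel (R : realType) (d : nat) (Phi : 'rV[R]_d -> R)
    (delta : R) : 'rV[R]_d -> R :=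
  fun v => delta ^- d * Phi (delta^-1 *: v).

Definition trial_space (R : realType) (d : nat) (n : nat)
    (x : nat -> 'rV[R]_d) (K : 'rV[R]_d -> R) : set ('rV[R]_d -> R) :=
  [set g | exists a : 'I_n -> R, g = fun z => \sum_(i < n) a i * K (z - x i)].

(* "The" element singled out by the cardinality conditions; see lagrange_funP
   and lagrange_fun_unique below. *)
Definition lagrange_fun (R : realType) (d : nat) (n : nat)
    (x : nat -> 'rV[R]_d) (K : 'rV[R]_d -> R) (i : nat) : 'rV[R]_d -> R :=
  get [set g | trial_space n x K g /\
               forall j, (j < n)%N -> g (x j) = (i == j)%:R].

Definition interp (R : realType) (d : nat) (n : nat)
    (x : nat -> 'rV[R]_d) (K : 'rV[R]_d -> R) (g : 'rV[R]_d -> R) :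
    'rV[R]_d -> R :=
  fun z => \sum_(i < n) g (x i) * lagrange_fun n x K i z.

(* In what follows N l is the number of points of level l and K l the kernel
   of level l; level 0 carries no interpolation operator. *)
Definition level_interp (R : realType) (d : nat) (N : nat -> nat)
    (x : nat -> 'rV[R]_d) (K : nat -> 'rV[R]_d -> R) (l : nat)
    (g : 'rV[R]_d -> R) : 'rV[R]_d -> R :=
  interp (N l) x (K l) g.

Fixpoint ml_error (R : realType) (d : nat) (N : nat -> nat)
    (x : nat -> 'rV[R]_d) (K : nat -> 'rV[R]_d -> R) (f : 'rV[R]_d -> R)
    (l : nat) : 'rV[R]_d -> R :=
  if l is l'.+1 then
    ml_error N x K f l' - level_interp N x K l (ml_error N x K f l')
  else f.

Definition multilevel (R : realType) (d : nat) (N : nat -> nat)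
    (x : nat -> 'rV[R]_d) (K : nat -> 'rV[R]_d -> R) (L : nat)
    (f : 'rV[R]_d -> R) : 'rV[R]_d -> R :=
  \sum_(1 <= l < L.+1) level_interp N x K l (ml_error N x K f l.-1).

(* A_L applied to a data vector: A_L (f) for some f in C(Om) interpolating the
   data. By multilevel_vecE below the choice of f is immaterial. *)
Definition multilevel_vec (R : realType) (d : nat) (Om : set 'rV[R]_d)
    (N : nat -> nat) (x : nat -> 'rV[R]_d) (K : nat -> 'rV[R]_d -> R)
    (L : nat) (y : 'rV[R]_(N L)) : 'rV[R]_d -> R :=
  multilevel N x K L
    (get [set f : 'rV[R]_d -> R | {within Om, continuous f} /\
                                  forall j : 'I_(N L), f (x j) = y 0 j]).

(* [enum u] lists u in increasing order, so the smallest level acts first. *)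
Definition interp_comp (R : realType) (d : nat) (N : nat -> nat)
    (x : nat -> 'rV[R]_d) (K : nat -> 'rV[R]_d -> R) (L : nat)
    (u : {set 'I_L.+1}) (f : 'rV[R]_d -> R) : 'rV[R]_d -> R :=
  foldl (fun g (k : 'I_L.+1) => level_interp N x K k g) f (enum u).

(* A_{l+1, ..., L} *)
Definition multilevel_from (R : realType) (d : nat) (N : nat -> nat)
    (x : nat -> 'rV[R]_d) (K : nat -> 'rV[R]_d -> R) (l L : nat)
    (f : 'rV[R]_d -> R) : 'rV[R]_d -> R :=
  fun z => \sum_(u : {set 'I_L.+1} | (u != finset.set0) &&
                                     [forall k in u, (l < k)%N])
             (-1) ^+ #|u|.+1 * interp_comp N x K u f z.

Lemma lagrange_fun_unique (R : realType) (d : nat) (n : nat)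
    (x : nat -> 'rV[R]_d) (K : 'rV[R]_d -> R) (g1 g2 : 'rV[R]_d -> R) :
  posdefmx (\matrix_(i < n, j < n) K (x i - x j)) ->
  trial_space n x K g1 -> trial_space n x K g2 ->
  (forall j, (j < n)%N -> g1 (x j) = g2 (x j)) -> g1 = g2.
Proof.
move=> [Asym Apos] [a ->] [b ->] eqab.
set A := (\matrix_(i, j) _) in Asym Apos.
pose v := \row_k (a k - b k).
have vA : v *m A = 0.
  apply/rowP => j; rewrite -Asym !mxE.
  under eq_bigr do rewrite !mxE mulrBl.
  by rewrite sumrB eqab ?subrr.
have v0 : v = 0.
  apply/eqP/negPn/negP => /Apos; rewrite vA mul0mx mxE.
  by rewrite ltxx.
apply/funext => z; apply: eq_bigr => k _; congr (_ * _).
by apply/eqP; rewrite -subr_eq0; move/rowP/(_ k): v0; rewrite !mxE => ->.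
Qed.

Lemma lagrange_funP (R : realType) (d : nat) (n : nat)
    (x : nat -> 'rV[R]_d) (K : 'rV[R]_d -> R) (i : nat) :
  posdefmx (\matrix_(i < n, j < n) K (x i - x j)) -> (i < n)%N ->
  trial_space n x K (lagrange_fun n x K i) /\
  forall j, (j < n)%N -> lagrange_fun n x K i (x j) = (i == j)%:R.
Proof.
move=> [Asym Apos] lt_in; set A := (\matrix_(i, j) _) in Asym Apos.
have Aunit : A \in unitmx.
  rewrite -row_free_unit -kermx_eq0; apply/negPn/negP => /rowV0Pn[v].
  move=> /sub_kermxP vA /Apos; rewrite vA mul0mx mxE.
  by rewrite ltxx.
pose a k := invmx A (Ordinal lt_in) k.
apply: (@xgetPex _ _ [set g | trial_space n x K g /\
  forall j, (j < n)%N -> g (x j) = (i == j)%:R]).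
exists (fun z => \sum_(k < n) a k * K (z - x k)); split; first by exists a.
move=> j lt_jn.
have /matrixP/(_ (Ordinal lt_in) (Ordinal lt_jn)) := mulVmx Aunit.
rewrite -{2}Asym !mxE => <-.
by apply: eq_bigr => k _; rewrite !mxE.
Qed.

Lemma multilevel_vecE (R : realType) (d : nat) (Om : set 'rV[R]_d)
    (N : nat -> nat) (x : nat -> 'rV[R]_d) (K : nat -> 'rV[R]_d -> R)
    (L : nat) (y : 'rV[R]_(N L)) (f : 'rV[R]_d -> R) :
  (forall l, (l < L)%N -> (N l <= N l.+1)%N) ->
  {within Om, continuous f} -> (forall j : 'I_(N L), f (x j) = y 0 j) ->
  multilevel_vec Om x K y = multilevel N x K L f.
Proof.
move=> Nmon fC fy; rewrite /multilevel_vec.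
have [|_ gy] := @xgetPex _ (point : 'rV[R]_d -> R)
  [set f | {within Om, continuous f} /\
           forall j : 'I_(N L), f (x j) = y 0 j]; first by exists f.
move: (xget _ _) gy => g gy.
have NL l : (l <= L)%N -> (N l <= N L)%N.
  move=> lL; rewrite -(subKn lL); elim: (L - l)%N => [|k IH]; first by rewrite subn0.
  have [kL|Lk] := ltnP k L.
    by apply: leq_trans IH; rewrite -(subnSK kL) Nmon// subnSK// leq_subr.
  by rewrite (_ : L - k.+1 = L - k)%N// (eqP (Lk : (L - k == 0)%N)) (eqP (leqW Lk : (L - k.+1 == 0)%N)).
have interpE l g1 g2 : (l <= L)%N ->
    (forall j, (j < N L)%N -> g1 (x j) = g2 (x j)) ->
    level_interp N x K l g1 = level_interp N x K l g2.
  move=> lL g12; apply/funext => z; apply: eq_bigr => k _.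
  by rewrite g12// (leq_trans (ltn_ord k) (NL _ lL)).
have errE l : (l <= L)%N -> forall j, (j < N L)%N ->
    ml_error N x K g l (x j) = ml_error N x K f l (x j).
  elim: l => [_ j jL|l IH lL j jL] /=.
    by rewrite (gy (Ordinal jL)) (fy (Ordinal jL)).
  rewrite (interpE _ _ (ml_error N x K f l))//; last exact/IH/ltnW.
  by rewrite !fctE (IH (ltnW lL)).
apply: eq_big_nat => l /andP[l0 lL]; apply: interpE => // j jL.
by apply: errE => //; rewrite (leq_trans (leq_pred l)).
Qed.

(* Main.v *)
Require Import Defs.
From HB Require Import structures.
From mathcomp Require Import all_boot all_order all_algebra.
From mathcomp Require Import all_classical all_reals all_analysis.
Set Implicit Arguments.
Unset Strict Implicit.
Unset Printing Implicit Defensive.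
Import Order.TTheory GRing.Theory Num.Theory.
Import numFieldNormedType.Exports.
Local Open Scope classical_set_scope.
Local Open Scope ring_scope.

(** Write [I_j] for the interpolation operator of level [j] and
    [R_l = (1 - I_L) ... (1 - I_(l+1))] for the operator that maps a function
    to its residual after the levels [l+1, ..., L].  Expanding the product
    shows that [R_l = 1 - A_(l+1, ..., L)]; conversely, splitting the subsets
    of [l+1, ..., L] according to whether they contain their smallest
    possible element [l+1] gives [R_l = R_(l+1) - R_(l+1) I_(l+1)]
    ([ml_residual_step]), which also identifies [R_0] with the operator that
    maps [f] to the final error [e_L] of the multilevel scheme
    ([ml_residual_error]).

    Summing the differences [R_j f - R_(j-1) f = R_j (I_j f)] over all levels
    telescopes to [R_L f - R_0 f = f - e_L = A_L f], so that for every [f]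

      [A_L f = \sum_(1 <= j <= L) (I_j f - A_(j+1, ..., L) (I_j f))]

    ([multilevel_telescope]).  Take for [f] a continuous function that is [1]
    at the [i]-th point and [0] at the other points.  Then [I_j f] vanishes as
    long as point [i] is absent from level [j], that is for [j < m], and is
    the cardinal function of level [j] afterwards; in the last term
    [A_(L+1, ..., L)] is zero, which leaves [chi L] alone.  A suitable [f] is
    the normalised product of the distances to the other points
    ([exists_continuous_cardinal]). *)

(** * Continuous functions with prescribed cardinal data *)

(** The multilevel operator acts on a data vector through a continuous function
    that attains the data; for a unit vector, the product of the distances to
    the other points is one, once it is scaled to be [1] at [y i]. *)
Lemma exists_continuous_cardinal (R : realType) (V : normedModType R) (n : nat)
    (y : 'I_n -> V) (i : 'I_n) : injective y ->
  exists2 f : V -> R, continuous f & forall j, f (y j) = (j == i)%:R.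
Proof.
move=> y_inj.
exists (fun z => \prod_(k < n | k != i) (`|z - y k| / `|y i - y k|)).
  move=> z; apply: cvg_big => [|k _]; first exact: mul_continuous.
  apply: cvgM; last exact: cvg_cst.
  by apply: cvg_norm; apply: cvgB; [exact: cvg_id | exact: cvg_cst].
move=> j; have [->|ji] := eqVneq j i.
  apply: big1 => k ki; rewrite divff// normr_eq0 subr_eq0.
  by apply: contraNneq ki => /y_inj ->.
by rewrite (bigD1 j)//= subrr normr0 mul0r mul0r.
Qed.

(** * Sets of levels and the order of composition *)

(** Compositions run through [enum u]; this is how the smallest level of a set
    comes to act first. *)
Lemma enum_setU1_min (n : nat) (a : 'I_n) (u : {set 'I_n}) :
  (forall k, k \in u -> (a < k)%N) -> enum (a |: u) = a :: enum u.
Proof.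
move=> a_lt.
pose lt_ord := relpre (val : 'I_n -> nat) ltn.
have lt_trans : transitive lt_ord by move=> k1 k2 k3; exact: ltn_trans.
have sorted_enum (v : {set 'I_n}) : sorted lt_ord (enum v).
  rewrite {1}/enum_mem -enumT; apply: sorted_filter => //.
  by rewrite -sorted_map val_enum_ord iota_ltn_sorted.
apply: (irr_sorted_eq lt_trans) => //; first by move=> k; exact: ltnn.
  rewrite /= path_min_sorted//; apply/allP => k.
  by rewrite mem_enum; exact: a_lt.
by move=> k; rewrite inE !mem_enum !inE.
Qed.

(** * Residuals after the last levels *)

Section Residual.
Variables (R : realType) (d : nat) (N : nat -> nat) (x : nat -> 'rV[R]_d).
Variables (K : nat -> 'rV[R]_d -> R) (L : nat).
Implicit Types (f g : 'rV[R]_d -> R) (u : {set 'I_L.+1}).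

Local Notation I := (level_interp N x K).
Local Notation Icomp := (@interp_comp R d N x K L).
Local Notation A l := (multilevel_from N x K l L).

(** As [ml_residualE] shows, this is the expanded form of the product
    [(1 - I_L) ... (1 - I_(l+1))] applied to [f]. *)
Definition ml_residual l f : 'rV[R]_d -> R := f - A l f.

Lemma level_interpB l f g : I l (f - g) = I l f - I l g.
Proof.
apply/funext => z; rewrite /level_interp /interp !fctE -sumrB.
by apply: eq_bigr => k _; rewrite mulrBl.
Qed.

Lemma interp_compB u f g : Icomp u (f - g) = Icomp u f - Icomp u g.
Proof.
rewrite /interp_comp; elim: (enum u) f g => [//|k s IH] f g /=.
by rewrite level_interpB IH.
Qed.

Lemma interp_comp0 f : Icomp finset.set0 f = f.
Proof. by rewrite /interp_comp enum_set0. Qed.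

Lemma interp_compU1 u (a : 'I_L.+1) f : (forall k, k \in u -> (a < k)%N) ->
  Icomp (a |: u) f = Icomp u (I a f).
Proof. by move=> a_lt; rewrite /interp_comp enum_setU1_min. Qed.

(** The term [f] is the contribution of the empty set of levels, and
    subtracting [A l f] turns its signs into those of the expanded product. *)
Lemma ml_residualE l f z :
  ml_residual l f z =
    \sum_(u : {set 'I_L.+1} | [forall k in u, (l < k)%N])
      (-1) ^+ #|u| * Icomp u f z.
Proof.
rewrite (bigD1 finset.set0) /=; last by apply/forall_inP => k; rewrite inE.
rewrite cards0 expr0 mul1r interp_comp0 /ml_residual !fctE; congr (_ + _).
rewrite /multilevel_from -sumrN; apply: eq_big => [u|u _]; first by rewrite andbC.
by rewrite exprS mulN1r mulNr opprK.
Qed.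

Lemma ml_residualB l f g :
  ml_residual l (f - g) = ml_residual l f - ml_residual l g.
Proof.
apply/funext => z; rewrite -[RHS]/(ml_residual l f z - ml_residual l g z).
rewrite !ml_residualE -sumrB; apply: eq_bigr => u _.
by rewrite interp_compB -mulrBr.
Qed.

Lemma ml_residual0 l : ml_residual l 0 = 0.
Proof. by rewrite -[X in ml_residual _ X](subrr 0) ml_residualB subrr. Qed.

Lemma ml_residual_last f : ml_residual L f = f.
Proof.
apply/funext => z; rewrite ml_residualE (big_pred1 finset.set0).
  by rewrite cards0 mul1r interp_comp0.
move=> u; apply/forall_inP/eqP => [noL|-> k]; last by rewrite inE.
apply/setP => k; rewrite inE; apply/negP => /noL.
by rewrite ltnNge -ltnS ltn_ord.
Qed.

(** A set of levels above [l] either avoids [l+1], or is [l+1] together with a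
    set of levels above [l+1]; in the second case [I_(l+1)] acts first and the
    sign flips. *)
Lemma ml_residual_step l f : (l < L)%N ->
  ml_residual l f = ml_residual l.+1 f - ml_residual l.+1 (I l.+1 f).
Proof.
move=> lL; apply/funext => z.
rewrite -[RHS]/(ml_residual l.+1 f z - ml_residual l.+1 (I l.+1 f) z).
rewrite !ml_residualE.
pose a : 'I_L.+1 := Ordinal (lL : (l.+1 < L.+1)%N).
(* The sets that avoid the level l+1 give the first term of the right-hand side. *)
rewrite (bigID (fun u => a \in u)) /= addrC; congr (_ + _).
  apply: eq_bigl => u; apply/andP/forall_inP => [[/forall_inP lu au] k ku|lu].
    rewrite ltn_neqAle lu// andbT; apply: contraNneq au => ak.
    by rewrite (_ : a = k)//; exact: val_inj.
  split; first by apply/forall_inP => k /lu /ltnW.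
  by apply/negP => /lu; rewrite ltnn.
(* The others are a |: u for a unique set u of levels above l+1. *)
rewrite (reindex_onto (fun u => a |: u) (fun u => u :\ a)) /=; last first.
  by move=> u /andP[_ au]; rewrite finset.setD1K.
rewrite -sumrN; apply: eq_big => [u|u /andP[/andP[/forall_inP lu _] /eqP ua]].
  rewrite finset.setU11 andbT.
  apply/andP/forall_inP => [[/forall_inP lu /eqP ua] k ku|lu].
    rewrite ltn_neqAle lu ?andbT ?inE ?ku ?orbT//; apply/negP => /eqP ak.
    have {ak} ak : k = a by exact/esym/val_inj.
    by move: ku; rewrite -ua ak !inE eqxx.
  have au : a \notin u by apply/negP => /lu; rewrite ltnn.
  split; last by rewrite finset.setU1K.
  by apply/forall_inP => k; rewrite !inE => /predU1P[->//|/lu /ltnW].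
have au : a \notin u by rewrite -ua !inE eqxx.
rewrite cardsU1 au exprS mulN1r mulNr interp_compU1// => k ku.
rewrite ltn_neqAle lu ?inE ?ku ?orbT// andbT.
by apply: contraNneq au => ak; rewrite (_ : a = k)//; exact: val_inj.
Qed.

(** Moving one factor [1 - I_(l+1)] at a time from the residual operator to the
    error, [R_0 f = R_l e_l] for all [l], and [R_L e_L = e_L]. *)
Lemma ml_residual_error f : ml_residual 0 f = ml_error N x K f L.
Proof.
rewrite -[RHS]ml_residual_last.
suff: forall l, (l <= L)%N ->
    ml_residual 0 f = ml_residual l (ml_error N x K f l) by exact.
elim=> [//|l IH lL].
by rewrite (IH (ltnW lL)) ml_residual_step// -ml_residualB.
Qed.

Lemma multilevelE f : multilevel N x K L f = f - ml_error N x K f L.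
Proof.
rewrite /multilevel big_add1 /=; elim: L => [|l IH] /=.
  by rewrite big_geq// subrr.
by rewrite big_nat_recr//= IH opprB [RHS]addrCA addrC.
Qed.

(** The terms are the increments [R_j f - R_(j-1) f] of the residual, by
    [ml_residual_step]. *)
Lemma multilevel_telescope f :
  multilevel N x K L f = \sum_(1 <= j < L.+1) (I j f - A j (I j f)).
Proof.
rewrite multilevelE -ml_residual_error -[X in X - _]ml_residual_last.
rewrite big_add1 /= -(telescope_sumr (fun l => ml_residual l f))//.
apply: eq_big_nat => l /andP[_ lL].
by rewrite (ml_residual_step _ lL) opprB addrC subrK.
Qed.

End Residual.


Theorem theorem3p6 (R : realType) (d : nat) (Om : set 'rV[R]_d)
    (L : nat) (N : nat -> nat) (x : nat -> 'rV[R]_d)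
    (Phi : 'rV[R]_d -> R) (c mu nu : R) (m : nat) (i : 'I_(N L))
    (d_gt0 : (0 < d)%N)
    (Om_nonempty : Om !=set0) (Om_open : open Om)
    (Om_connected : connected Om) (Om_bounded : bounded_set Om)
    (N0 : N 0%N = 0%N) (N1 : (0 < N 1%N)%N)
    (N_nested : forall l, (1 <= l < L)%N -> (N l <= N l.+1)%N)
    (x_in : forall j, (j < N L)%N -> Om (x j))
    (x_distinct : forall j k, (j < N L)%N -> (k < N L)%N -> x j = x k -> j = k)
    (mu_bounds : 0 < mu < 1) (c_bounds : 0 < c <= 1) (nu_gt1 : 1 < nu)
    (fill_decay : forall l, (1 <= l < L)%N ->
       c * mu * fill_distance Om x (N l) <= fill_distance Om x (N l.+1)
         <= mu * fill_distance Om x (N l))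
    (Phi_continuous : continuous Phi)
    (Phi_radial : radial Phi)
    (Phi_posdef : positive_definite Phi)
    (Phi_support : closure [set v | Phi v != 0] `<=` [set v | enorm v <= 1])
    (m_range : (1 <= m <= L)%N)
    (i_range : (N m.-1 <= i < N m)%N) :
  let K l := scaled_kernel Phi (nu * fill_distance Om x (N l)) in
  let chi l := lagrange_fun (N l) x (K l) i in
  multilevel_vec Om x K (delta_mx 0 i : 'rV[R]_(N L)) =
    chi L + \sum_(m <= l < L) (chi l - multilevel_from N x K l L (chi l)).
Proof.
move=> K chi; have [m_gt0 mL] := andP m_range; have [Nm_le i_lt] := andP i_range.
have N_mono l : (l < L)%N -> (N l <= N l.+1)%N.
  by case: l => [_|l lL]; [rewrite N0 | exact: N_nested].
have N_le k l : (k <= l <= L)%N -> (N k <= N l)%N.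
  move=> /andP[]; elim: l => [|l IH]; first by rewrite leqn0 => /eqP ->.
  rewrite leq_eqVlt ltnS => /predU1P[->//|kl] lL.
  exact: leq_trans (IH kl (ltnW lL)) (N_mono _ lL).
have [|f f_cont f_card] := @exists_continuous_cardinal R 'rV[R]_d (N L) (fun j => x j) i.
  by move=> j k /x_distinct jk; exact/val_inj/jk.
have fx j : (j < N L)%N -> f (x j) = (j == i)%:R.
  by move=> jL; rewrite (f_card (Ordinal jL)).
rewrite (@multilevel_vecE _ _ _ _ _ _ _ _ f)//; last 2 first.
- exact: continuous_subspaceT.
- by move=> j; rewrite f_card mxE eqxx.
have interp_below l : (l < m)%N -> level_interp N x K l f = 0.
  move=> lm; have Nl : (N l <= i)%N.
    by apply: leq_trans Nm_le; apply: N_le; rewrite -ltnS prednK// lm (leq_trans (leq_pred m)).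
  apply/funext => z; apply: big1 => k _.
  have ki := leq_trans (ltn_ord k) Nl.
  by rewrite fx ?(ltn_trans ki)// ltn_eqF// mul0r.
have interp_from l : (m <= l <= L)%N -> level_interp N x K l f = chi l.
  move=> /andP[ml lL]; have il : (i < N l)%N.
    by apply: leq_trans i_lt _; apply: N_le; rewrite ml.
  apply/funext => z; rewrite /level_interp /interp (bigD1 (Ordinal il))//= big1.
    by rewrite fx// eqxx mul1r addr0.
  move=> k ki; rewrite fx; last by apply: leq_trans (ltn_ord k) (N_le _ _ _); rewrite lL leqnn.
  by rewrite (_ : (k == i :> nat) = false) ?mul0r//; apply: contraNF ki.
(* The levels below m contribute nothing, and the level L contributes chi L. *)
rewrite multilevel_telescope (@big_cat_nat _ _ _ m)//=; last exact: leqW.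
rewrite big_nat big1 ?add0r => [|l /andP[_ lm]]; last first.
  by rewrite interp_below//; exact: ml_residual0.
rewrite big_nat_recr//= addrC interp_from ?mL ?leqnn//; congr (_ + _).
  exact: ml_residual_last.
apply: eq_big_nat => l /andP[ml lL].
by rewrite interp_from// ml ltnW.
Qed.
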